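(* Let $X$ be a finite discrete topological space with at least two elements, let $\Gamma$ be a nonempty set, and let $\varphi:\Gamma\to\Gamma$ be an arbitrary map. Let $\sigma_\varphi:X^\Gamma\to X^\Gamma$, $\sigma_\varphi((x_\theta)_{\theta\in\Gamma})=(x_{\varphi(\theta)})_{\theta\in\Gamma}$, be the associated generalized shift, where $X^\Gamma$ carries the product topology and its unique compatible uniform structure $\mathcal U$. The dynamical system $(X^\Gamma,\sigma_\varphi)$ has uniform stroboscopical property if and only if $\varphi:\Gamma\to\Gamma$ is one-to-one.
   Context: Uniform structure on $X^\Gamma$: for $H\subseteq\Gamma$ let $\alpha_H:=\{((x_\theta)_{\theta\in\Gamma},(y_\theta)_{\theta\in\Gamma})\in X^\Gamma\times X^\Gamma:\forall\theta\in H\ (x_\theta=y_\theta)\}$. The unique compatible uniform structure on the compact Hausdorff space $X^\Gamma$ is $\mathcal U:=\{D\subseteq X^\Gamma\times X^\Gamma:$ there exists a finite subset $H$ of $\Gamma$ with $\alpha_H\subseteq D\}$. Uniform stroboscopical property: let $(Z,\mathcal F)$ be a uniform space, $f:Z\to Z$ continuous, and $\mathbb N=\{1,2,\ldots\}$. The dynamical system $(Z,f)$ has uniform stroboscopical property if for every strictly increasing sequence $A=\{n_i\}_{i\ge0}$ in $\mathbb N$ there exist a subsequence $B=\{k_i\}_{i\ge0}$ of $A$ and a map $\varrho:Z\to Z$ (not assumed continuous) such that the sequence $\{f^{k_i}\circ\varrho\}_{i\ge0}$ converges uniformly (with respect to $\mathcal F$) to the identity map $id_Z$. *)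

(* Defs.v *)
From HB Require Import structures.
From mathcomp Require Import all_boot all_order.
From mathcomp Require Import finmap.
From mathcomp Require Import all_classical all_reals all_analysis.

Set Implicit Arguments.
Unset Strict Implicit.
Unset Printing Implicit Defensive.

Local Open Scope classical_set_scope.

(* The positivity of [A] encodes that sequences take values in {1, 2, ...}.
   The map [rho] is an arbitrary function. *)
Definition uniform_stroboscopical (Z : uniformType) (f : continuousType Z Z) :=
  forall A : nat -> nat, increasing_seq A -> (forall i, 0 < A i) ->
  exists s : nat -> nat, increasing_seq s /\
  exists rho : Z -> Z,
    {uniform, (fun i => iter (A (s i)) f \o rho) @ \oo --> (idfun : Z -> Z)}.

Definition full_shift (Gamma : Type) (X : finType) : uniformType :=
  {ptws Gamma -> discrete_topology X}.

Definition generalized_shift (Gamma : Type) (X : finType)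
    (phi : Gamma -> Gamma) : full_shift Gamma X -> full_shift Gamma X :=
  fun x theta => x (phi theta).

Arguments generalized_shift {Gamma} X phi.

Definition alpha (Gamma : Type) (X : finType) (H : set Gamma) :
    set (full_shift Gamma X * full_shift Gamma X) :=
  [set xy | forall theta, H theta -> xy.1 theta = xy.2 theta].

Arguments alpha {Gamma} X H.

(* The uniformity supplied by the library is the one generated by the sets
   [alpha X H] with [H] finite. *)
Lemma full_shift_entourageP (Gamma : Type) (X : finType)
    (D : set (full_shift Gamma X * full_shift Gamma X)) :
  entourage D <-> exists2 H : set Gamma, finite_set H & alpha X H `<=` D.
Proof.
split.
  move=> [_ [F _ <-] FD].
  pose I : {fset {classic Gamma}} := [fset (val w).1 | w in F]%fset.
  exists [set` I]; first exact: (@finite_fset {classic Gamma} I).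
  move=> [x y] xy; apply: FD => -[[i E] /= iE] wF.
  have /asboolP [/= B entB] := iE; apply.
  move: entB; rewrite uniform_discrete => entB; apply: entB.
  exists (x i) => //=; congr pair; apply: xy => /=.
  by apply/imfsetP; eexists; [exact: wF|].
case=> H finH HD; apply: (@filterS _ entourage _ _ _ HD).
have {finH} [F ->] : exists F : {fset {classic Gamma}}, H = [set` F].
  exact/(@finite_fsetP {classic Gamma} H).
have -> : alpha X [set` F] = \bigcap_(i in [set` F]) alpha X [set i].
  rewrite eqEsubset; split=> [xy xyF i iF _ -> |xy xyF i iF]; first exact: xyF.
  exact: (xyF i iF i).
apply: filter_bigI => i _.
have entX : `[< @entourage (initial_topology (@proj Gamma _ i))
    (alpha X [set i]) >].
  apply/asboolP; exists (range (fun a : discrete_topology X => (a, a))) => //.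
  by move=> [x y] [a _ [ax ay]] _ -> /=; rewrite -[LHS]ax.
exists (alpha X [set i]) => //.
exists [fset exist _ (i, alpha X [set i]) entX]%fset; first by move=> ? _; exact: in_setT.
rewrite eqEsubset; split=> xy.
  by move=> /(_ (exist _ (i, alpha X [set i]) entX)); apply; rewrite /= inE.
by move=> xyi w /=; rewrite inE => /eqP ->.
Qed.

Lemma generalized_shift_continuous (Gamma : Type) (X : finType)
    (phi : Gamma -> Gamma) : continuous (generalized_shift X phi).
Proof.
move=> x B /nbhsP[D /full_shift_entourageP[H finH HD] DB].
have entH : entourage (alpha X (phi @` H)).
  apply/full_shift_entourageP; exists (phi @` H) => //.
  exact: finite_image.
rewrite nbhs_simpl; apply: filterS (nbhs_entourage x entH) => y /xsectionP xy.
apply: DB; apply/mem_set/HD => theta Htheta.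
by apply: xy; exists theta.
Qed.

HB.instance Definition _ (Gamma : Type) (X : finType) (phi : Gamma -> Gamma) :=
  isContinuous.Build _ _ _ (@generalized_shift_continuous Gamma X phi).

(* Main.v *)
Require Import Defs.
From mathcomp Require Import all_boot all_order.
From mathcomp Require Import zify finmap.
From mathcomp Require Import all_classical all_reals all_analysis.
Local Open Scope classical_set_scope.

(** Iterating the shift [k] times composes a configuration with the [k]-th
    iterate of [phi], so uniform convergence of [sigma^k_i \o rho] to the
    identity says: for each [theta], once [i] is large, the coordinate
    [phi^k_i theta] of [rho z] is [z theta], for all [z] at once.

    If [phi a = phi b], then, all [k_i] being positive, this forces
    [z a = z b] for all [z], hence [a = b] because there are two letters.

    Conversely let [phi] be injective.  The configuration [rho z] can be
    written down as soon as the points [phi^k_i theta], for [i >= T theta],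
    determine [theta], where [T] is some threshold function: [rho] is then the
    generalized shift of a decoding map [Gamma -> Gamma].  Two kinds of
    collision [phi^k_i theta = phi^k_j theta'] have to be excluded.
    - On a finite orbit of length [p], collisions are avoided if [k_i] and
      [k_j] agree modulo [p].  By compactness of the profinite integers (here:
      an ultrafilter on the indices), a subsequence of the given sequence is
      eventually constant modulo every [p]
      ([subsequence_sparse_residues]).
    - On an infinite orbit, a collision makes [theta] the image of [theta']
      under [phi^(k_j - k_i)].  Measuring both points from a base point chosen
      in their orbit bounds this exponent in terms of [theta] and [theta']
      separately ([orbit_threshold]), whereas the subsequence can be taken so
      sparse that [k_j - k_i > j].  The bound [maxn (T theta) (T theta')]
      treats the infinitely many other points of the orbit at once: the later
      of the two times [i] and [j] is at least both thresholds, so that the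
      gap [k_j - k_i] violates the bound. *)

(** * Subsequences with prescribed gaps and residues *)

(** An ultrafilter contains one cell of each finite partition; applied to the
    residue classes of [A] modulo each [p] and to an ultrafilter finer than
    [\oo], this yields residues that are realized simultaneously, for finitely
    many moduli, at arbitrarily large indices. *)
Lemma recurrent_residues (A : nat -> nat) :
  exists r : nat -> nat, forall n M, exists m,
    M < m /\ forall p, 0 < p <= n -> A m %% p = r p.
Proof.
have [U [UU ooU]] := @ultraFilterLemma nat \oo _.
have UF : ProperFilter U := ultra_proper.
have res p : exists r, 0 < p -> U [set m | A m %% p = r].
  have [p0|p0] := ltnP 0 p; last by exists 0.
  apply: contrapT => nores.
  have Uc (r : nat) : U (~` [set m | A m %% p = r]).
    have [Ur|//] := in_ultra_setVsetC [set m | A m %% p = r] UU.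
    by case: nores; exists r.
  have Uall : U [set m | forall i : 'I_p, A m %% p <> i].
    by apply: filter_forall => i; exact: Uc.
  have [m /(_ (Ordinal (ltn_pmod (A m) p0)))] := filter_ex Uall.
  exact.
have [r rU] := choice res; exists r => n M.
have Un : U [set m | forall i : 'I_n, A m %% i.+1 = r i.+1].
  by apply: filter_forall => i; exact: rU.
have UM : U [set m | M < m] by apply: ooU; exact: nbhs_infty_gt.
have [m [Mm mr]] := filter_ex (filterI UM Un).
by exists m; split=> // -[|p] // pn; exact: (mr (Ordinal pn)).
Qed.

(** The [i]-th chosen index realizes the recurrent residues modulo all
    [p <= i]; since [A] grows at least as fast as its index, wide gaps between
    the indices give wide gaps between the values. *)
Lemma subsequence_sparse_residues (A : nat -> nat) : increasing_seq A ->
  exists s : nat -> nat, [/\ increasing_seq s,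
    forall i j, i < j -> A (s i) + j < A (s j) &
    forall p i j, 0 < p <= i -> i <= j -> A (s i) = A (s j) %[mod p]].
Proof.
move=> Ainc; have [r rA] := recurrent_residues A.
have Alt i j : i < j -> A i < A j by move=> ij; rewrite (leqW_mono Ainc).
have Aadd i d : A i + d <= A (i + d).
  by elim: d => [|d IH]; rewrite ?addn0 // !addnS (leq_ltn_trans IH) // Alt.
have [g gA] := choice (fun nM => rA nM.1 nM.2).
pose s := fix s i := if i is j.+1 then g (i, s j + i) else g (0, 0).
have sS i : s i + i.+1 < s i.+1 by have [] := gA (i.+1, s i + i.+1).
have sinc : increasing_seq s.
  by apply/increasing_seqP => i; apply: leq_ltn_trans (sS i); exact: leq_addr.
have sr p i : 0 < p <= i -> A (s i) %% p = r p.
  by case: i => [|i] pi; [have [_] := gA (0, 0)|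
    have [_] := gA (i.+1, s i + i.+1)]; apply.
exists s; split=> // [i [//|j] ij|p i j /andP[p0 pi] ij].
  apply: (@leq_ltn_trans (A (s j + j.+1))); last exact/Alt/sS.
  apply: leq_trans (Aadd _ _); rewrite leq_add2r.
  have : s i <= s j by have := sinc i j; rewrite !leEnat => ->.
  rewrite leq_eqVlt => /predU1P[-> //|/Alt]; exact: ltnW.
by rewrite !sr ?p0 // (leq_trans pi).
Qed.

(** * Orbits of an injective map *)

(** Points are compared through a base point [b] of their orbit, common to both:
    [phi^m theta = phi^n b] and [phi^m' theta' = phi^n' b] express their
    position relative to [b], and away from the finite orbits [d] is the
    difference of the positions.  Hence [2 * (m + n)] can serve as threshold;
    on a finite orbit the threshold is made at least as large as a period. *)
Lemma orbit_threshold (Gamma : Type) (phi : Gamma -> Gamma) : injective phi ->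
  exists T : Gamma -> nat, forall theta theta' d, iter d phi theta' = theta ->
    d <= maxn (T theta) (T theta') \/
    exists p, 0 < p <= T theta /\ iter p phi theta = theta.
Proof.
move=> phiI.
have iterI k : injective (iter k phi) by elim: k => // k IH x y /phiI /IH.
pose orb t := [set b | exists mn, iter mn.1 phi t = iter mn.2 phi b].
have orbb t : orb t t by exists (0, 0).
have orb_iter d t : orb (iter d phi t) = orb t.
  rewrite eqEsubset; split=> b [[m n] /= e].
    by exists (m + d, n); rewrite /= iterD.
  by exists (m, d + n); rewrite /= -iterD addnC !iterD e.
(* A representative is chosen for each set of points, so that points on the
   same orbit, having equal sets [orb], receive the same one. *)
have [c cP] : {c : set Gamma -> option Gamma &
    forall S b, S b -> exists2 b', c S = Some b' & S b'}.
  apply: (@choice _ _ (fun S o => forall b, S b ->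
    exists2 b', o = Some b' & S b')).
  move=> S; have [[b Sb]|S0] := pselect (S !=set0).
    by exists (Some b) => *; exists b.
  by exists None => b Sb; case: S0; exists b.
have [N NP] : {N : Gamma -> nat * nat & forall t b, c (orb t) = Some b ->
    iter (N t).1 phi t = iter (N t).2 phi b}.
  apply: (@choice _ _ (fun t mn => forall b, c (orb t) = Some b ->
    iter mn.1 phi t = iter mn.2 phi b)) => t.
  have [b cb [mn e]] := cP _ _ (orbb t).
  by exists mn => b'; rewrite cb => -[<-].
have [per perP] : {per : Gamma -> nat & forall t,
    (exists2 p, 0 < p & iter p phi t = t) ->
    0 < per t /\ iter (per t) phi t = t}.
  apply: (@choice _ _ (fun t q => (exists2 p, 0 < p & iter p phi t = t) ->
    0 < q /\ iter q phi t = t)) => t.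
  have [[p p0 pt]|np] := pselect (exists2 p, 0 < p & iter p phi t = t).
    by exists p.
  by exists 0 => /np.
exists (fun t => per t + ((N t).1 + (N t).2).*2) => t t' d tt'.
have [/perP[p0 pt]|np] := pselect (exists2 p, 0 < p & iter p phi t = t).
  by right; exists (per t); rewrite p0 leq_addr.
left; have [b cb _] := cP _ _ (orbb t).
have et := NP _ _ cb.
have /NP et' : c (orb t') = Some b by rewrite -cb -tt' orb_iter.
set m := (N t).1 in et *; set n := (N t).2 in et *.
set m' := (N t').1 in et' *; set n' := (N t').2 in et' *.
(* Composing the two measurements with the base point gives
   [phi^(m + n') t = phi^(n + m') t'], to which [phi^d] is applied. *)
have e : iter (d + (m + n')) phi t = iter (n + m') phi t.
  have -> : iter (d + (m + n')) phi t = iter (d + n + n') phi b.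
    by rewrite addnA addnAC iterD et -iterD addnAC.
  have -> : iter (n + m') phi t = iter (d + n + m') phi t'.
    by rewrite -tt' -iterD; congr iter; lia.
  by rewrite !iterD et'.
have dle : d <= n + m'.
  rewrite leqNgt; apply/negP => lt_d; apply: np.
  have lt_dmn : n + m' < d + (m + n') by apply: ltn_addr.
  (* [e] would make the difference of its exponents a period of [t]. *)
  exists (d + (m + n') - (n + m')); first by rewrite subn_gt0.
  by apply: (iterI (n + m')); rewrite -iterD subnKC // ltnW.
apply: leq_trans dle _; rewrite leq_max.
have [mn|nm] := leqP m' n; apply/orP; [left|right].
- by rewrite addnC -addnn; lia.
- by lia.
Qed.

(** A collision between different times is a collision between points of one
    orbit, at distance the gap [k j - k i]: too long for an infinite orbit, and
    a multiple of a period on a finite one. *)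
Lemma sparse_residues_separate (Gamma : Type) (phi : Gamma -> Gamma)
    (k : nat -> nat) : injective phi ->
  (forall i j, i < j -> k i + j < k j) ->
  (forall p i j, 0 < p <= i -> i <= j -> k i = k j %[mod p]) ->
  exists T : Gamma -> nat, forall theta theta' i j,
    T theta <= i -> T theta' <= j ->
    iter (k i) phi theta = iter (k j) phi theta' -> theta = theta'.
Proof.
move=> phiI gap res; have [T TP] := orbit_threshold _ _ phiI; exists T.
have iterI n : injective (iter n phi) by elim: n => // n IH x y /phiI /IH.
move=> t t' i j; wlog ij : t t' i j / i <= j.
  move=> W Ti Tj e; have [ij|/ltnW ji] := leqP i j; first exact: W ij Ti Tj e.
  by apply/esym; apply: W ji Tj Ti (esym e).
move=> Ti; move: ij; rewrite leq_eqVlt => /predU1P[<- _ /iterI //|ij] Tj e.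
have kij := gap _ _ ij.
have kle : k i <= k j by lia.
have dt : iter (k j - k i) phi t' = t.
  by apply: (iterI (k i)); rewrite -iterD subnKC.
have [|[p [/andP[p0 pT] pt]]] := TP _ _ _ dt; first by lia.
have /eqP pdvd : k i == k j %[mod p].
  by rewrite (res p i j) ?p0 ?(leq_trans pT) ?(ltnW ij).
(* [T t <= i] bounds the period of [t], the point taken at the earlier time, so
   the residue condition lets [t] be moved from time [i] to time [j]. *)
apply: (iterI (k j)); rewrite -e.
have /dvdnP[q qE] : p %| k j - k i by rewrite -eqn_mod_dvd // pdvd.
by rewrite -(subnKC kle) iterD qE iterM (iter_fix q).
Qed.

(** * Uniform convergence along a generalized shift *)

Lemma iter_generalized_shift (Gamma : Type) (X : finType)
    (phi : Gamma -> Gamma) k (z : full_shift Gamma X) theta :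
  iter k (generalized_shift X phi) z theta = z (iter k phi theta).
Proof.
by elim: k theta => //= k IH theta; rewrite /generalized_shift IH -iterSr.
Qed.

(** The entourages [alpha X H] with [H] a singleton suffice, since uniform
    closeness on a finite [H] is a finite conjunction of such conditions. *)
Lemma uniform_cvg_shiftP (Gamma : Type) (X : finType) (phi : Gamma -> Gamma)
    (k : nat -> nat) (rho : full_shift Gamma X -> full_shift Gamma X) :
  {uniform, (fun i => iter (k i) (generalized_shift X phi) \o rho) @ \oo -->
     (idfun : full_shift Gamma X -> full_shift Gamma X)} <->
  forall theta, \forall i \near \oo,
    forall z, rho z (iter (k i) phi theta) = z theta.
Proof.
split=> [cvg theta|ev].
  have ent : entourage (alpha X [set theta]).
    by apply/full_shift_entourageP; exists [set theta].
  have [|N _ NP] :=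
    cvg [set h | forall z, setT z -> alpha X [set theta] (z, h z)].
    apply/uniform_nbhs; exists (alpha X [set theta]).
    by split; [exact: ent|move=> h].
  exists N => // i Ni z.
  by have := NP i Ni z I theta erefl; rewrite /= iter_generalized_shift.
move=> P /uniform_nbhs[E [/full_shift_entourageP[H Hfin HE] EP]].
have [F HF] : exists F : {fset {classic Gamma}}, H = [set` F].
  exact/(@finite_fsetP {classic Gamma} H).
have HN : \forall i \near \oo, (\bigcap_(theta in [set` F])
    [set i | forall z, rho z (iter (k i) phi theta) = z theta]) i.
  by apply: filter_bigI => theta _; exact: ev.
apply: filterS HN => i iH; apply: EP => z _; apply: HE => theta.
by rewrite HF => /iH /(_ z) /= <-; rewrite iter_generalized_shift.
Qed.

Theorem theorem4p6 (X : finType) (Gamma : Type) (phi : Gamma -> Gamma) :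
  1 < #|X| -> [set: Gamma] !=set0 ->
  uniform_stroboscopical (generalized_shift X phi) <-> injective phi.
Proof.
move=> /card_gt1P[x [y [_ _ xy]]] _; split=> [strob a b ab|phiI A Ainc Apos].
  (* All times are positive, so [phi] is applied at least once to [a] and [b]. *)
  have [|//|s [_ [rho /uniform_cvg_shiftP cvg]]] := strob succn.
    by move=> m n; rewrite !leEnat.
  apply: contrapT => neq_ab.
  have [i [ia ib]] := filter_ex (filterI (cvg a) (cvg b)).
  pose z : full_shift Gamma X := fun t => if `[< t = a >] then x else y.
  have : z a = z b by rewrite -ia -ib !iterSr ab.
  rewrite /z asboolT // asboolF; last exact/nesym.
  by apply/eqP.
have [s [sinc gap res]] := subsequence_sparse_residues _ Ainc.
have [T sep] := sparse_residues_separate _ _ (A \o s) phiI gap res.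
exists s; split=> //.
(* [decode] inverts the partial map from [phi^k_i theta] to [theta]. *)
have [decode decodeP] : {g : Gamma -> Gamma & forall u theta i,
    T theta <= i -> iter (A (s i)) phi theta = u -> g u = theta}.
  apply: (@choice _ _ (fun u v => forall theta i,
    T theta <= i -> iter (A (s i)) phi theta = u -> v = theta)) => u.
  have [[[t i] [/= Ti tu]]|none] := pselect (exists ti : Gamma * nat,
      T ti.1 <= ti.2 /\ iter (A (s ti.2)) phi ti.1 = u).
    by exists t => t' j Tj t'u; apply: (sep _ _ i j) => //=; rewrite tu.
  by exists u => t i Ti tu; case: none; exists (t, i).
exists (generalized_shift X decode); apply/uniform_cvg_shiftP => theta.
exists (T theta) => // i /= Ti z.
by rewrite /generalized_shift (decodeP _ theta i).
Qed.
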